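(* Let $X$ and $Z$ be Hausdorff, locally convex topological vector spaces, let $C\subseteq Z$ be a convex, pointed cone, and let $K$ be a nonempty, convex and closed subset of $X$. Let $D\subseteq K$ be a self segment-dense set in $K$ and consider a mapping $f:K\times K\to Z$ satisfying (i) for all $y\in D$, the mapping $x\mapsto f(x,y)$ is strongly $C$-upper semicontinuous on $K$; (ii) for all $x\in K$, the mapping $y\mapsto f(x,y)$ is strongly $C$-upper semicontinuous on $K\setminus D$; (iii) for all $x\in D$, the mapping $y\mapsto f(x,y)$ is $C$-convex on $D$; (iv) for all $x\in D$, $f(x,x)\notin -C\setminus\{0\}$; (v) there exist a compact set $K_0\subseteq X$ and $y_0\in D$ such that $f(x,y_0)\in -C\setminus\{0\}$ for all $x\in K\setminus K_0$. Then there exists $x_0\in K$ such that $f(x_0,y)\notin -C\setminus\{0\}$ for all $y\in K$.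
   Context: All vector spaces are real. $\operatorname{cl}$ denotes closure. $-C\setminus\{0\}$ denotes $(-C)\setminus\{0\}=-(C\setminus\{0\})$. The interior of $C$ is allowed to be empty. A set $C\subseteq Z$ is a cone if $tc\in C$ for all $c\in C$ and $t\ge 0$; it is convex if $C+C=C$, and pointed if $C\cap(-C)=\{0\}$. Write $z_1\le z_2$ iff $z_2-z_1\in C$. Strong $C$-upper semicontinuity: a map $g:K\to Z$ is strongly $C$-upper semicontinuous at $x\in K$ if for any $k\in C\setminus\{0\}$ there exists a neighborhood $U$ of $x$ such that $g(u)\in g(x)+k-(C\setminus\{0\})$ for all $u\in U\cap K$. It is strongly $C$-upper semicontinuous on a subset $S\subseteq K$ if it is so, as a map on $K$, at every point of $S$. $C$-convexity: for a (not necessarily convex) set $D$, $g$ is $C$-convex on $D$ if for all $n\in\mathbb N$, $x_1,\dots,x_n\in D$ and $\lambda_1,\dots,\lambda_n\ge 0$ with $\sum_{i=1}^n\lambda_i=1$ such that $\sum_{i=1}^n\lambda_i x_i\in D$, one has $g\left(\sum_{i=1}^n\lambda_i x_i\right)\le\sum_{i=1}^n\lambda_i g(x_i)$. Self segment-dense set: let $U\subseteq V\subseteq X$ with $V$ convex. $U$ is self segment-dense in $V$ if $U$ is dense in $V$ (i.e. $V\subseteq\operatorname{cl}U$) and for all $x,y\in U$ the set $[x,y]\cap U$ is dense in $[x,y]$, where $[x,y]=\{x+t(y-x):t\in[0,1]\}$. *)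

(* Defs.v *)
From mathcomp Require Import all_boot all_order all_algebra.
From mathcomp Require Import all_classical all_reals all_analysis.

Set Implicit Arguments.
Unset Strict Implicit.
Unset Printing Implicit Defensive.

Import Order.TTheory GRing.Theory Num.Theory.

Local Open Scope classical_set_scope.
Local Open Scope ring_scope.

Definition is_cone (R : numDomainType) (Z : lmodType R) (C : set Z) :=
  forall (t : R) (c : Z), 0 <= t -> C c -> C (t *: c).

(* C + C = C, which for a cone amounts to convexity. *)
Definition is_convex_cone (R : numDomainType) (Z : lmodType R) (C : set Z) :=
  is_cone C /\ [set a + b | a in C & b in C] = C.

Definition is_pointed (Z : zmodType) (C : set Z) :=
  C `&` [set - c | c in C] = [set 0].

Definition cone_le (Z : zmodType) (C : set Z) (z1 z2 : Z) := C (z2 - z1).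

Definition neg_cone0 (Z : zmodType) (C : set Z) : set Z :=
  [set - c | c in C] `\ 0.

(* In the definitions below a map g : K -> Z is represented by a total function
   X -> Z, of which only the values on K are ever used. *)
Definition strongly_usc_at (X : topologicalType) (Z : zmodType) (C : set Z)
    (K : set X) (g : X -> Z) (x : X) :=
  forall k : Z, (C `\ 0) k ->
    exists2 U : set X, nbhs x U &
      forall u, (U `&` K) u -> [set g x + k - c | c in C `\ 0] (g u).

Definition strongly_usc_on (X : topologicalType) (Z : zmodType) (C : set Z)
    (K S : set X) (g : X -> Z) :=
  forall x, S x -> strongly_usc_at C K g x.

Definition C_convex_on (R : numDomainType) (X Z : lmodType R) (C : set Z)
    (D : set X) (g : X -> Z) :=
  forall (n : nat) (x : 'I_n -> X) (l : 'I_n -> R),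
    (forall i, D (x i)) -> (forall i, 0 <= l i) -> \sum_(i < n) l i = 1 ->
    D (\sum_(i < n) l i *: x i) ->
    cone_le C (g (\sum_(i < n) l i *: x i)) (\sum_(i < n) l i *: g (x i)).

Definition segment (R : numDomainType) (X : lmodType R) (x y : X) : set X :=
  [set x + t *: (y - x) | t in [set t : R | 0 <= t <= 1]].

(* The library's [dense] is density in the whole space; this is density in V. *)
Definition dense_in (X : topologicalType) (U V : set X) := V `<=` closure U.

(* Meant for U `<=` V with V convex. *)
Definition self_segment_dense (R : numDomainType) (X : tvsType R)
    (U V : set X) :=
  dense_in U V /\
  forall x y, U x -> U y -> dense_in (segment x y `&` U) (segment x y).

(* Main.v *)
Require Import Defs.
From mathcomp Require Import all_boot zify.

(** The sets [F y = {x in K | f x y notin -C \ {0}}], for [y] in [D], are closed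
    by (i), and [F y0] is compact by (v). If [x] in [D] is a convex combination of
    [y_1, ..., y_n] in [D], then by (iii) and (iv) it lies in some [F y_i] with
    [y_i] of nonzero weight; since self segment-density makes the points of [D]
    dense in every polytope with vertices in [D], this covering property extends
    to the whole polytope, so the KKM lemma gives a common point of finitely many
    [F y], and compactness one of all of them. Condition (ii) passes from [D]
    to [K].

    The KKM lemma is derived from Scarf's version of Sperner's lemma: for a finite
    set of points with one total order per colour, a parity argument over the
    "dominant" sets replaces triangulations. Applied to the grid points of the
    simplex ordered by their coordinates, dominant sets have small diameter. *)

Set Implicit Arguments.
Unset Strict Implicit.
Unset Printing Implicit Defensive.

(** * Sperner's parity argument *)

Section Parity.
Variables (I V : finType) (R : {set {set V}}) (c : V -> I).
Hypothesis R_card : forall S, S \in R -> #|S| = #|I|.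
(** Members of [R] are called rooms, and a room less one vertex a door: every door lies in exactly
    two rooms. *)
Hypothesis R_two : forall S a, S \in R -> a \in S ->
  #|[set x | (x \notin S :\ a) && (x |: S :\ a \in R)]| = 2.

(** If [S] is colourful, only the removal of its vertex of colour [i0] works. Otherwise one such
    door [S :\ a] forces the colour of [a] to be shared with a single [a'], and these two removals
    are the only ones. *)
Lemma odd_doors (i0 : I) (S : {set V}) : #|S| = #|I| ->
  odd #|[set a in S | c @: (S :\ a) == [set~ i0]]| = (c @: S == setT).
Proof.
move=> cS; case: eqP => [cT|cT].
  have cinj : {in S &, injective c} by apply/imset_injP; rewrite cT cardsT cS.
  have : i0 \in c @: S by rewrite cT inE.
  case/imsetP => a aS ai0.
  suff -> : [set a0 in S | c @: (S :\ a0) == [set~ i0]] = [set a] by rewrite cards1.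
  apply/setP => b; rewrite !inE; apply/andP/eqP => [[bS /eqP E]|->].
    apply: contraTeq (set11 i0) => ba; rewrite -in_setC -E ai0.
    by apply: imset_f; rewrite !inE eq_sym ba.
  split=> //; apply/eqP/setP => j; rewrite !inE.
  apply/imsetP/idP => [[z /setD1P [za zS] ->]|ji0].
    by apply: contraNneq za => cz; apply/eqP/cinj => //; rewrite cz.
  have : j \in c @: S by rewrite cT inE.
  case/imsetP => z zS jz; exists z => //; rewrite !inE zS andbT.
  by apply: contraNneq ji0 => za; rewrite jz za ai0.
set A := [set a in S | _].
have [->|[a]] := set_0Vmem A; first by rewrite cards0.
rewrite inE => /andP [aS /eqP cA].
have cinj : {in S :\ a &, injective c}.
  apply/imset_injP; rewrite cA cardsC1 -cS.
  by rewrite (cardsD1 a S) aS.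
have ca : c a != i0.
  apply/eqP => ca; apply: cT; apply/setP => j; rewrite inE.
  rewrite -(setD1K aS) imsetU1 cA ca !inE; exact: orbN.
have : c a \in c @: (S :\ a) by rewrite cA !inE.
case/imsetP => a' a'S caa'.
have [a'a {}a'S'] : a' != a /\ a' \in S by move/setD1P: a'S.
suff -> : A = [set a; a'] by rewrite cards2 eq_sym a'a.
apply/setP => x; rewrite !inE; apply/andP/orP => [[xS /eqP Ex]|].
  case: (eqVneq x a) => xa; first by left.
  case: (eqVneq x a') => xa'; first by right.
  have : {in S :\ x &, injective c}.
    apply/imset_injP; rewrite Ex cardsC1 -cS (cardsD1 x S) xS //.
  move/(_ a a'); rewrite !inE aS a'S' ![_ == x]eq_sym xa xa' => /(_ isT isT caa').
  by move=> E; rewrite E eqxx in a'a.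
case=> /eqP ->; rewrite ?aS ?cA //; split=> //.
rewrite -cA eqEsubset; apply/andP; split; apply/subsetP => j /imsetP [z]; rewrite !inE.
  move=> /andP [za' zS] ->; case: (eqVneq z a) => [->|za].
    by rewrite caa' imset_f.
  by rewrite imset_f // !inE za.
move=> /andP [za zS] ->; case: (eqVneq z a') => [->|za'].
  by rewrite -caa' imset_f // !inE eq_sym a'a.
by rewrite imset_f // !inE za'.
Qed.

Lemma odd_sum (J : finType) (P : pred J) (F : J -> nat) :
  odd (\sum_(j | P j) F j) = odd #|[set j | P j && odd (F j)]|.
Proof.
rewrite -sum1_card (bigID (fun j => odd (F j))) /= oddD.
rewrite (_ : odd (\sum_(i | P i && ~~ odd (F i)) F i) = false) ?addbF; last first.
  by elim/big_rec: _ => // j n /andP [_ /negbTE oF] on; rewrite oddD oF on.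
under [in RHS]eq_bigl do rewrite inE.
by elim/big_rec2: _ => // j n m /andP [_ oF] on; rewrite !oddD on oF.
Qed.

(** Pairs of a room and a removed vertex whose door has colours [[set~ i0]] are counted in two ways:
    by room, their number has the parity of the number of colourful rooms; by door, it is even. *)
Theorem colorful_even (i0 : I) : odd #|[set S in R | c @: S == setT]| = false.
Proof.
pose A := [set p : {set V} * V |
  [&& p.1 \in R, p.2 \in p.1 & c @: (p.1 :\ p.2) == [set~ i0]]].
transitivity (odd #|A|); first symmetry.
  rewrite -sum1_card (partition_big fst (mem R)) /=; last by move=> p; rewrite inE => /and3P[].
  rewrite odd_sum; congr (odd #|pred_of_set _|); apply/setP => S; rewrite !inE.
  case: (boolP (S \in R)) => //= SR.
  rewrite -(odd_doors i0 (R_card SR)); congr odd.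
  rewrite sum1_card -[RHS](card_imset _ (_ : injective (pair S))) => [|x y []//].
  apply: eq_card => -[S' a]; apply/andP/imsetP => /=; rewrite inE /=; last first.
    by case=> b; rewrite inE => /andP [bS bc] [-> ->]; rewrite SR bS bc.
  by move=> [/and3P [_ aS ac] /eqP <-]; exists a => //; rewrite inE aS ac.
rewrite -sum1_card (partition_big (fun p => p.1 :\ p.2) predT) //=.
rewrite odd_sum (_ : [set j | _] = set0) ?cards0 //; apply/setP => t; rewrite !inE.
apply/negbTE; rewrite sum1_card.
pose B := [pred p | (p \in A) && (p.1 :\ p.2 == t)]. rewrite -[_ && _]/(odd #|B|).
have [[S a] /= Bp|B0] := pickP B; last by rewrite (eq_card0 B0).
have /= := Bp; rewrite !inE /= => /andP [/and3P [SR aS Sc] /eqP tE].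
rewrite (_ : #|B| = 2) // -(R_two SR aS) tE.
rewrite -[RHS](card_imset _ (_ : injective (fun x => (x |: t, x)))) => [|x y []//].
apply: eq_card => -[S' b]; apply/idP/imsetP.
  rewrite !inE /= => /andP [/and3P [S'R bS' cb] /eqP tE']; exists b; rewrite ?inE -tE' ?setD1K //.
  by rewrite S'R !inE eqxx.
case=> x; rewrite inE => /andP [xt xR] [-> ->]; rewrite !inE /= eqxx /= xR /=.
by rewrite setU1K // -tE Sc eqxx.
Qed.
End Parity.

(** * Dominant sets *)

Section Dominance.
Variables (I V : finType) (r : I -> V -> nat).
Hypothesis r_inj : forall i, injective (r i).

(** For nonempty [S]: no [y] lies strictly above the minimum of [S] in every direction at once. *)
Definition dominant (S : {set V}) :=
  [forall y, exists i, forall z in S, r i y <= r i z].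

Lemma dominantP (S : {set V}) :
  reflect (forall y, exists i, forall z, z \in S -> r i y <= r i z) (dominant S).
Proof.
apply: (iffP forallP) => H y.
  by have /existsP [i /forall_inP Hi] := H y; exists i.
by have [i Hi] := H y; apply/existsP; exists i; apply/forall_inP.
Qed.

Lemma dominantS (S S' : {set V}) : S' \subset S -> dominant S -> dominant S'.
Proof.
move=> /subsetP sS /dominantP H; apply/dominantP => y.
by have [i Hi] := H y; exists i => z /sS /Hi.
Qed.

Definition is_argmin (S : {set V}) (m : I -> V) :=
  forall i, m i \in S /\ forall z, z \in S -> r i (m i) <= r i z.

Lemma exists_argmin (S : {set V}) : S != set0 -> exists m, is_argmin S m.
Proof.
case/set0Pn => z0 z0S; exists (fun i => [arg min_(z < z0 in S) r i z]) => i.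
by case: arg_minnP.
Qed.

Lemma is_argmin_uniq (S : {set V}) m i z : is_argmin S m -> z \in S ->
  (forall w, w \in S -> r i z <= r i w) -> m i = z.
Proof.
move=> mS zS zm; apply: (@r_inj i); apply/eqP; rewrite eqn_leq.
by rewrite (mS i).2 // zm // (mS i).1.
Qed.

(** Dominance applied to a vertex of [S] makes it the minimum in some direction, so [m] is onto [S];
    equal cardinalities then give injectivity. *)
Lemma argmin_bij (S : {set V}) m : #|S| = #|I| -> dominant S -> is_argmin S m ->
  injective m /\ forall z, z \in S -> exists i, z = m i.
Proof.
move=> cS /dominantP dS mS.
have mSE : m @: setT = S.
  apply/setP => z; apply/imsetP/idP => [[i _ ->]|zS]; first by case: (mS i).
  have [i Hi] := dS z; exists i => //.
  exact/esym/(is_argmin_uniq mS).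
split; last by move=> z; rewrite -mSE => /imsetP [i _ ->]; exists i.
have /imset_injP minj : #|m @: setT| == #|[set: I]| by rewrite mSE cardsT cS.
by move=> x y; apply: minj; rewrite inE.
Qed.

(* A door of a dominant room has two directions [i], [j] sharing their minimum,
   and is completed by the extremal elements of the two corresponding regions. *)
Lemma dominant_pivot (S : {set V}) (a : V) (s : I -> V) :
  #|S| = #|I| -> dominant S -> a \in S ->
  (forall j, exists2 t, t \in S :\ a & forall k, k != j -> r k t < r k (s j)) ->
  #|[set x | (x \notin S :\ a) && dominant (x |: S :\ a)]| = 2.
Proof.
move=> cS dS aS ex_t; set t := S :\ a.
have S0 : S != set0 by apply/set0Pn; exists a.
have [m mS] := exists_argmin S0; have [minj msurj] := argmin_bij cS dS mS.
have [i ai] := msurj _ aS.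
have t0 : t != set0 by have [z zt _] := ex_t i; apply/set0Pn; exists z.
have [mu mut] := exists_argmin t0.
have dt : dominant t by apply: dominantS dS; apply: subD1set.
have mumE k : k != i -> mu k = m k.
  move=> ki; apply: (is_argmin_uniq mut).
    rewrite !inE (mS k).1 andbT ai.
    by apply: contraNneq ki => /minj ->.
  by move=> w /setD1P [_ wS]; apply: (mS k).2.
have [j mj] : exists j, mu i = m j.
  by apply: msurj; have /setD1P [] := (mut i).1.
have ij : i != j.
  by apply/eqP => ij; have := (mut i).1; rewrite mj -ij -ai !inE eqxx.
have muij : mu i = mu j by rewrite [RHS]mumE 1?eq_sym.
(* These points exceed the minima of [t] in all directions but [l]. The completions of [t] turn out
   to be the [r l]-largest points of [M l], for [l = i] and [l = j]. *)
pose M l y := forall k, k != l -> r k (mu k) < r k y.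
have M_out l y : (l = i \/ l = j) -> M l y -> y \notin t.
  move=> lij My; apply/negP => yt.
  have /setD1P [ya yS] := yt; have [k yk] := msurj _ yS.
  have ki : k != i by apply: contraNneq ya => ki; rewrite yk ki ai.
  have ymu : y = mu k by rewrite mumE.
  case: (eqVneq k l) => [kl|/My]; last by rewrite ymu ltnn.
  case: lij => lE; first by rewrite kl lE eqxx in ki.
  have := My i; rewrite lE => /(_ ij).
  by rewrite ymu kl lE -muij ltnn.
have M_dom l y : M l y -> forall w, w \in t -> r l y <= r l w.
  move=> My w wt; have /dominantP /(_ y) [k Hk] := dt.
  case: (eqVneq k l) => [<-|/My]; first exact: Hk.
  by rewrite ltnNge Hk // (mut k).1.
have M_disj y : M i y -> M j y -> False.
  move=> Mi Mj; have /dominantP /(_ y) [k Hk] := dt.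
  have : r k (mu k) < r k y.
    by case: (eqVneq k i) => [->|/Mi //]; apply: Mj.
  by rewrite ltnNge Hk // (mut k).1.
have max_dom l x : (l = i \/ l = j) -> M l x -> (forall y, M l y -> r l y <= r l x) ->
    dominant (x |: t).
  move=> lij Mx xmax; apply/dominantP => y.
  have [/forall_inP My|] := boolP [forall (k | k != l), r k (mu k) < r k y].
    exists l => w /setU1P [->|wt]; first exact: xmax.
    exact: M_dom.
  rewrite negb_forall => /existsP [k]; rewrite negb_imply -leqNgt => /andP [kl yk].
  exists k => w /setU1P [->|wt]; first by apply: leq_trans yk (ltnW (Mx _ kl)).
  by apply: leq_trans yk ((mut k).2 _ wt).
(* Each vertex of a dominant [x |: t] is the minimum in exactly one direction. The other minima are
   those of [t], so [mu i = mu j] leaves only [i] or [j] to [x]. *)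
have dom_max x : x \notin t -> dominant (x |: t) ->
    exists l, [/\ l = i \/ l = j, M l x & forall y, M l y -> r l y <= r l x].
  move=> xt dx; have cx : #|x |: t| = #|I|.
    by rewrite cardsU1 xt -cS (cardsD1 a S) aS.
  have x0 : x |: t != set0 by apply/set0Pn; exists x; rewrite setU11.
  have [m' mx] := exists_argmin x0; have [m'inj m'surj] := argmin_bij cx dx mx.
  have [l xl] := m'surj _ (setU11 _ _).
  have m'E k : k != l -> m' k = mu k.
    move=> kl; symmetry; apply: (is_argmin_uniq mut).
      have /setU1P [E|//] := (mx k).1.
      by move/eqP: kl; case; apply: m'inj; rewrite E.
    by move=> w wt; apply: (mx k).2; rewrite inE wt orbT.
  exists l; split.
  - case: (eqVneq l i) => li; first by left.
    case: (eqVneq l j) => lj; first by right.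
    have : m' i = m' j by rewrite !m'E 1?eq_sym.
    by move/m'inj/eqP; rewrite (negbTE ij).
  - move=> k kl; rewrite -m'E // ltn_neqAle (mx k).2 ?setU11 // andbT.
    apply: contra kl => /eqP /r_inj; rewrite xl => /m'inj -> //.
  - move=> y My; have /dominantP /(_ y) [k Hk] := dx.
    case: (eqVneq k l) => [kl|kl]; first by rewrite -kl; apply: Hk; apply: setU11.
    have := My _ kl; rewrite ltnNge Hk // inE -(m'E k kl).
    by rewrite (m'E k kl) (mut k).1 orbT.
have Mi_a : M i a.
  move=> k ki; rewrite mumE // ltn_neqAle (mS k).2 // andbT.
  apply: contra ki => /eqP /r_inj; rewrite ai => /minj -> //.
have a_max y : M i y -> r i y <= r i a.
  move=> My; have /dominantP /(_ y) [k Hk] := dS.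
  case: (eqVneq k i) => [<-|ki]; first exact: Hk.
  by have := My _ ki; rewrite ltnNge mumE // Hk // (mS k).1.
(* The point [s j] shows that [M j] is nonempty, so that a largest point [b] exists. *)
have Msj : M j (s j).
  move=> k kj; have [z zt /(_ _ kj)] := ex_t j.
  by apply: leq_ltn_trans; apply: (mut k).2.
pose Mb y := [forall (k | k != j), r k (mu k) < r k y].
have MbP y : reflect (M j y) (Mb y) by apply: forall_inP.
have [b /MbP Mj_b b_max] : exists2 b, Mb b & forall y, M j y -> r j y <= r j b.
  case: (@arg_maxnP _ (s j) Mb (r j)); first exact/MbP.
  by move=> b Hb bm; exists b => // y /MbP /bm.
have -> : [set x | (x \notin t) && dominant (x |: t)] = [set a; b].
  apply/setP => x; rewrite !inE -[_ && (x \in S)]in_setD1 -/t; apply/andP/orP.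
    move=> [xt /(dom_max _ xt) [l [[->|->] Mx xmax]]].
      by left; apply/eqP/(@r_inj i)/eqP; rewrite eqn_leq a_max // xmax.
    by right; apply/eqP/(@r_inj j)/eqP; rewrite eqn_leq b_max // xmax.
  case=> /eqP ->.
    by split; [apply: (M_out i) => //; left|apply: (max_dom i) => //; left].
  by split; [apply: (M_out j) => //; right|apply: (max_dom j) => //; right].
rewrite cards2; case: eqVneq => // ab.
by case: (M_disj a) => //; rewrite ab.
Qed.

End Dominance.

(** * Scarf's lemma: colourful dominant sets *)

Section Scarf.
Variables (I T : finType) (r : I -> T -> nat) (c : T -> I).
Hypothesis r_inj : forall i, injective (r i).

Let V : finType := (T + I)%type.
Let s (i : I) : V := inr i.
Let cV (v : V) : I := match v with inl x => c x | inr j => j end.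
(* The slack vertex [s i] is the least one in direction [i] and lies above all of
   [T] in the other directions: these vertices close up the boundary, so that
   every door lies in exactly two rooms once [slacks] is counted as a room. *)
Let rV (i : I) (v : V) : nat :=
  match v with
  | inl x => (r i x).+1
  | inr j => if j == i then 0 else (\max_x r i x).+2 + enum_rank j
  end.

Let rV_inl i x j : j != i -> rV i (inl x) < rV i (s j).
Proof.
by move=> /negbTE ji; rewrite /= ji ltn_addr // !ltnS; apply: leq_bigmax.
Qed.

Let rV_slack i v : rV i (s i) <= rV i v.
Proof. by rewrite /= eqxx. Qed.

Let rV_inj i : injective (rV i).
Proof.
move=> [x|j] [y|k] //.
- by move=> [/r_inj ->].
- case: (eqVneq k i) => [->|ki]; first by rewrite /= eqxx.
  by move=> E; have := rV_inl x ki; rewrite E ltnn.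
- case: (eqVneq j i) => [->|ji]; first by rewrite /= eqxx.
  by move=> E; have := rV_inl y ji; rewrite E ltnn.
- rewrite /=; case: (eqVneq j i) => [->|ji]; case: (eqVneq k i) => [->|ki] //.
  by move=> /eqP; rewrite eqn_add2l => /eqP /ord_inj /enum_rank_inj ->.
Qed.

Let slacks : {set V} := s @: setT.

Let rooms : {set {set V}} := slacks |: [set S : {set V} | (#|S| == #|I|) && dominant rV S].

Let card_slacks : #|slacks| = #|I|.
Proof. by rewrite card_imset ?cardsT // => i j []. Qed.

Let mem_slacks v : (v \in slacks) = if v is inr _ then true else false.
Proof.
case: v => [x|i]; last by apply/imsetP; exists i.
by apply/negP => /imsetP [].
Qed.

Let rooms_card S : S \in rooms -> #|S| = #|I|.
Proof. by rewrite !inE => /orP [/eqP ->|/andP [/eqP]]. Qed.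

Hypothesis t0 : T.


(** A door containing a point of [T] falls under [dominant_pivot]. A door of slacks misses one slack
    [s k]: its completions are [s k], which gives [slacks], and the point of [T] largest in
    direction [k]. *)
Let rooms_two S a : S \in rooms -> a \in S ->
  #|[set x | (x \notin S :\ a) && (x |: S :\ a \in rooms)]| = 2.
Proof.
move=> SR aS; set t := S :\ a.
have ct x : x \notin t -> #|x |: t| = #|I|.
  by move=> xt; rewrite cardsU1 xt -(rooms_card SR) (cardsD1 a S) aS.
have [/existsP [z zt]|] := boolP [exists z, inl z \in t].
  have zS : inl z \in S by move/setD1P: zt => [].
  have dS : dominant rV S.
    have := SR; rewrite !inE => /orP [/eqP SE|/andP [_ //]].
    by rewrite SE mem_slacks in zS.
  rewrite -(dominant_pivot rV_inj (s := s) (rooms_card SR) dS aS); last first.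
    by move=> j; exists (inl z) => // k kj; apply: rV_inl; rewrite eq_sym.
  apply: eq_card => x; rewrite !inE -[_ && (x \in S)]in_setD1 -/t.
  case: (boolP (x \in t)) => //= xt; rewrite ct // eqxx /=.
  by case: eqVneq => //= E; have := setU1r x zt; rewrite E mem_slacks.
rewrite negb_exists => /forallP tS.
have tsub : t \subset slacks.
  apply/subsetP => -[z|i] zt; last by rewrite mem_slacks.
  by have := tS z; rewrite zt.
have ctI : #|t|.+1 = #|I| by rewrite -(rooms_card SR) (cardsD1 a S) aS.
have [k kt tE] : exists2 k, s k \notin t & t = slacks :\ s k.
  have : t != slacks by apply/eqP => E; move: ctI; rewrite E card_slacks; lia.
  move=> tns; have : t \proper slacks by rewrite properEneq tns.
  case/properP => _ [[x|k]]; first by rewrite mem_slacks.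
  move=> _ kt; exists k => //.
  apply/eqP; rewrite eqEcard; apply/andP; split.
    apply/subsetP => z zt; rewrite in_setD1 (subsetP tsub) // andbT.
    by apply: contraNneq kt => E; rewrite E in zt.
  have := cardsD1 (s k) slacks; rewrite mem_slacks card_slacks -ctI /= add1n => -[->]; exact: leqnn.
have tm i : (s i \in t) = (i != k).
  by rewrite tE in_setD1 mem_slacks andbT; congr negb; apply/eqP/eqP => [[]|->].
pose b := [arg max_(x > t0) r k x].
have b_max x : r k x <= r k b by rewrite /b; case: arg_maxnP => // i _; apply.
rewrite (_ : [set x | _] = [set s k; inl b]) ?cards2 //.
apply/setP => -[x|i]; rewrite in_set in_set2; last first.
  rewrite orbF tm negbK; case: (eqVneq i k) => [->|ik]; last first.
    by symmetry; apply/eqP => -[] /eqP; rewrite (negbTE ik).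
  by rewrite eqxx /= tE setD1K ?mem_slacks // !inE eqxx.
rewrite tS /= /rooms in_setU1 in_set ct ?tS // eqxx andTb.
rewrite (_ : (_ == slacks) = false) /=; last first.
  by apply/eqP => E; have := setU11 (inl x) t; rewrite E mem_slacks.
(* Dominance is tested on [inl b]: a direction [l != k] is impossible, since the slack [s l] of [t]
   has rank 0 there. *)
apply/dominantP/eqP => [/(_ (inl b)) [l Hl]|[->]].
  case: (eqVneq l k) => [lk|lk].
    congr inl; apply: (@r_inj k); apply/eqP; rewrite eqn_leq b_max /=.
    by have := Hl _ (setU11 _ _); rewrite /= ltnS lk.
  by have := Hl (s l); rewrite in_setU1 tm lk orbT /= eqxx => /(_ isT).
case=> [y|j].
  exists k => z /setU1P [->|zt]; first by rewrite /= ltnS.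
  have := subsetP tsub _ zt; case: z zt => [z|i zt _]; first by rewrite mem_slacks.
  by apply/ltnW/rV_inl; rewrite -tm.
by exists j => z _; apply: rV_slack.
Qed.

(** The room [slacks] is colourful, so by parity there is another colourful room; its points in [T]
    form the desired set. A direction dominating a point of [T] cannot be the colour of a slack of
    the room, whose rank there is 0, so it is the colour of a point of [T]. *)
Theorem scarf : exists S : {set T}, forall y, exists2 i, i \in c @: S &
  forall z, z \in S -> r i y <= r i z.
Proof.
have cslacks : cV @: slacks == setT.
  rewrite eqEsubset subsetT; apply/subsetP => i _; apply/imsetP.
  by exists (s i); rewrite ?mem_slacks.
have := colorful_even cV rooms_card rooms_two (c t0).
set Q := [set S in _ | _] => Q_even.
have sQ : slacks \in Q by rewrite !inE eqxx cslacks.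
have : Q :\ slacks != set0.
  apply: contraFneq Q_even => Q0; by rewrite (cardsD1 slacks) sQ Q0 cards0.
case/set0Pn => S; rewrite !inE => /and3P [Ss SR /eqP cS].
move: SR; rewrite (negbTE Ss) /= => /andP [/eqP cardS dS].
have cinj : {in S &, injective cV} by apply/imset_injP; rewrite cS cardsT cardS.
exists [set x | inl x \in S] => y.
have /dominantP /(_ (inl y)) [i Hi] := dS; exists i; last first.
  by move=> z; rewrite inE => /Hi.
have : i \in cV @: S by rewrite cS inE.
case/imsetP => -[x xS ->|j jS ij]; first by apply: imset_f; rewrite inE.
by have := Hi _ jS; rewrite ij /= eqxx.
Qed.

End Scarf.

(** * Sperner's lemma on the grid points of a simplex *)

Lemma sum_extra n (A : {set 'I_n}) (i0 : 'I_n) (F : 'I_n -> nat) (k : nat) : i0 \in A ->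
  \sum_i (if i \in A then F i + (if i == i0 then k else 0) else 0) = \sum_(i in A) F i + k.
Proof.
move=> i0A; rewrite -big_mkcond big_split /=; congr addn.
rewrite -big_mkcondr /= (eq_bigl (pred1 i0)) ?big_pred1_eq // => i /=.
by case: eqVneq => [->|]; rewrite ?i0A ?andbF.
Qed.

Lemma leq_term_sum (I : finType) (P : pred I) (F : I -> nat) i :
  P i -> F i <= \sum_(j | P j) F j.
Proof. by move=> Pi; rewrite (bigD1 i) //= leq_addr. Qed.

(** No boundary condition is put on [lab]: instead, [q] is supported on the set [C] of labels that
    Scarf's lemma provides. *)
Lemma grid_sperner n N (lab : ('I_n -> nat) -> 'I_n) : 0 < n ->
  exists2 q : 'I_n -> nat, \sum_i q i = N &
    forall i, q i != 0 -> exists z : 'I_n -> nat, [/\ \sum_j z j = N, lab z = i &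
      forall j, q j <= z j + n.*2 /\ z j <= q j + n.*2].
Proof.
move=> n0.
pose T := {x : {ffun 'I_n -> 'I_N.+1} | \sum_i x i == N}.
pose gr (x : T) : 'I_n -> nat := fun i => val x i.
have sum_gr (x : T) : \sum_i gr x i = N by exact/eqP/(valP x).
have mkT (y : 'I_n -> nat) : \sum_i y i = N -> exists x : T, gr x =1 y.
  move=> yN; have yi i : y i < N.+1 by rewrite ltnS -yN (leq_term_sum (P := predT)).
  pose x := [ffun i => inord (y i) : 'I_N.+1].
  have xE i : x i = y i :> nat by rewrite ffunE inordK.
  have xN : \sum_i x i == N by rewrite -[X in _ == X]yN; apply/eqP/eq_bigr.
  by exists (exist _ x xN) => i; apply: xE.
(* The coordinate [i], with ties broken by an enumeration of the grid. *)
pose r i (x : T) := gr x i * #|{: T}| + enum_rank x.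
have r_inj i : injective (r i).
  move=> x y /(congr1 (modn^~ #|{: T}|)); rewrite /r !modnMDl !modn_small //.
  by move/ord_inj/enum_rank_inj.
have r_le i x y : r i x <= r i y -> gr x i <= gr y i.
  apply: contraTT; rewrite -!ltnNge => yx.
  have : (gr y i).+1 * #|{: T}| <= gr x i * #|{: T}| by rewrite leq_mul2r yx orbT.
  move=> H; apply: leq_trans (leq_trans _ H) (leq_addr _ _).
  by rewrite mulSn [X in _ <= X]addnC -addnS leq_add2l.
have [t0 _] : exists x : T, gr x =1 (fun i => if i == Ordinal n0 then N else 0).
  by apply: mkT; rewrite -big_mkcond big_pred1_eq.
have [S HS] := scarf (fun x => lab (gr x)) r_inj t0.
set C := [set _ | x in S] in HS.
have [i0 i0C _] := HS t0.
have [z0 z0S _] := imsetP i0C.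
pose m i := gr [arg min_(z < z0 in S) gr z i] i.
have m_le z i : z \in S -> m i <= gr z i.
  by rewrite /m; case: arg_minnP => // x _ H /H.
have m_ge i k : (forall z, z \in S -> k <= gr z i) -> k <= m i.
  by rewrite /m; case: arg_minnP => // x xS _; apply.
(* Otherwise adding one to each [m i] would give a grid point undominated by [S]. *)
have Hm : N < \sum_(i in C) (m i).+1.
  rewrite ltnNge; apply/negP => le_mN.
  have := sum_extra (fun i => (m i).+1) (N - \sum_(i in C) (m i).+1) i0C.
  rewrite (subnKC le_mN) => /mkT [y yE].
  have [i iC Hi] := HS y.
  have : gr y i <= m i by apply: m_ge => z /Hi /r_le.
  by rewrite yE iC leqNgt ltnS leq_addr.
have sumC z : \sum_(i in C) gr z i + \sum_(i | i \notin C) gr z i = N.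
  by rewrite -(sum_gr z) [RHS](bigID (mem C)).
have cC : #|C| <= n by rewrite -[X in _ <= X]card_ord max_card.
(* The left-hand side is [N] minus the sum of the [m i] over [C], hence less than [#|C|] by [Hm]. *)
have Hsum z : z \in S ->
    \sum_(i in C) (gr z i - m i) + \sum_(i | i \notin C) gr z i < n.
  move=> zS; have := sumC z.
  have -> : \sum_(i in C) gr z i = \sum_(i in C) m i + \sum_(i in C) (gr z i - m i).
    by rewrite -big_split; apply: eq_bigr => i _; rewrite /= subnKC ?m_le.
  have : N < \sum_(i in C) m i + #|C|.
    by rewrite -sum1_card -big_split /=; under eq_bigr do rewrite addn1.
  move: cC; lia.
have inC z i : z \in S -> i \in C -> gr z i < m i + n.
  move=> zS iC; have : gr z i - m i <= \sum_(j in C) (gr z j - m j).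
    exact: (leq_term_sum (fun i => gr z i - m i)).
  have := Hsum z zS; have := m_le z i zS; lia.
have outC z : z \in S -> \sum_(i | i \notin C) gr z i < n by move/Hsum; lia.
(* [q] is [z0] with its mass outside the face [C] moved to the vertex [i0]. *)
pose e := \sum_(i | i \notin C) gr z0 i.
exists (fun i => if i \in C then gr z0 i + (if i == i0 then e else 0) else 0).
  by rewrite sum_extra.
move=> i; case: ifP => // iC _; case/imsetP: (iC) => z zS iz; exists (gr z); split => //.
move=> j; have := outC _ z0S; rewrite -/e => e_lt.
have [jC|jC] := boolP (j \in C).
  have := inC _ _ zS jC; have := inC _ _ z0S jC.
  have := m_le _ j zS; have := m_le _ j z0S; case: ifP => _; lia.
have : gr z j <= \sum_(k | k \notin C) gr z k by exact: leq_term_sum.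
have := outC _ zS; lia.
Qed.

(* Imported only here: these libraries shadow many lemmas of finset. *)
From mathcomp Require Import all_order all_algebra.
From mathcomp Require Import all_classical all_reals all_analysis.
From mathcomp Require Import finmap lra.

Import Order.TTheory GRing.Theory Num.Theory.
Import numFieldNormedType.Exports.

Local Open Scope classical_set_scope.
Local Open Scope ring_scope.

(** * The KKM lemma *)

Section KKM.
Variables (R : realType) (n : nat).

Definition simplex : set 'rV[R]_n :=
  [set p | (forall i, 0 <= p ord0 i) /\ \sum_i p ord0 i = 1].

Lemma simplex_compact : compact simplex.
Proof.
have -> : simplex = [set v : 'rV[R]_n | forall i, `[0, 1]%classic (v ord0 i)] `&`
    (fun p : 'rV[R]_n => \sum_i p ord0 i) @^-1` [set 1].
  apply/seteqP; split=> [p [p0 p1]|p [pI p1]]; split => //=.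
  - move=> i; rewrite /= in_itv /= p0 -p1 (bigD1 i) //= lerDl.
    by apply: sumr_ge0 => j _; apply: p0.
  - by move=> i; have := pI i; rewrite /= in_itv => /andP[].
apply: compact_closedI.
  have := @rV_compact R n (fun=> `[0, 1]%classic); apply=> i; exact: segment_compact.
apply: preimage_closed; last exact: closed_eq.
move=> p _; apply: (continuous_big (op := +%R)); first exact: add_continuous.
by move=> i _; exact: coord_continuous.
Qed.

(** The open complements of the [G i] cover the simplex, which is compact; [e] is a Lebesgue number
    of this cover. *)
Lemma lebesgue_number (G : 'I_n -> set 'rV[R]_n) :
  (forall i, closed (G i)) -> (forall p, simplex p -> exists i, ~ G i p) ->
  exists2 e : R, 0 < e &
    forall p, simplex p -> exists i, forall q, ball p e q -> ~ G i q.
Proof.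
move=> Gcl Gcov; have /compact_near_coveringP := simplex_compact.
move=> /(_ _ 0^'+ (fun (e : R) p => exists i, forall q, ball p e q -> ~ G i q)) [].
  move=> p /Gcov [i Gip].
  have : nbhs p (~` G i) by apply: open_nbhs_nbhs; split => //; apply: closed_openC.
  move=> /nbhs_ballP [d /= d0 dG].
  exists (ball p (d / 2), [set e | e < d / 2]).
    split; first by apply: nbhsx_ballx; rewrite divr_gt0.
    by apply: nbhs_right_lt; rewrite divr_gt0.
  move=> [p' e] /= [pp' ed]; exists i => q p'q; apply: dG.
  by apply: ball_split pp' _; apply: le_ball p'q; apply: ltW.
move=> e0 /= e0_gt0 He.
exists (e0 / 2); first by rewrite divr_gt0.
apply: He; last by rewrite divr_gt0.
by rewrite /= sub0r normrN gtr0_norm ?divr_gt0 // ltr_pdivrMr // mulr_natr mulr2n ltrDl.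
Qed.

(** Without a common point, each [p] can be labelled by an [i] such that [G i] misses a ball of
    fixed radius around [p]. The grid point [q] is close to points of every label in its support,
    hence in no [G i] of its support. *)
Theorem KKM_simplex (G : 'I_n -> set 'rV[R]_n) : (0 < n)%N ->
  (forall i, closed (G i)) ->
  (forall p, simplex p -> exists2 i, p ord0 i != 0 & G i p) ->
  exists2 p, simplex p & forall i, G i p.
Proof.
move=> n0 Gcl Gcov; apply: contrapT => noG.
have [p|e e0 He] := lebesgue_number Gcl.
  move=> Dp; apply: contrapT => /forallNP H; apply: noG; exists p => // i.
  by apply: contrapT; apply: H.
have [lab Hlab] : exists lab : 'rV[R]_n -> 'I_n,
    forall p, simplex p -> forall q, ball p e q -> ~ G (lab p) q.
  suff /choice [lab] : forall p, exists i, simplex p -> forall q, ball p e q -> ~ G i q.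
    by exists lab.
  move=> p; have [/He [i Hi]|np] := pselect (simplex p); first by exists i.
  by exists (Ordinal n0).
(* Grid displacements of at most [n.*2] become smaller than [e] once divided by [N.+1]. *)
have [N N_large] : exists N : nat, (n.*2.+1)%:R / e < N.+1%:R.
  exists (Num.trunc ((n.*2.+1)%:R / e)).
  by rewrite -truncn_lt_nat ?divr_ge0 // ltW.
pose sc (z : 'I_n -> nat) : 'rV[R]_n := \row_i ((z i)%:R / N.+1%:R).
have N0 : 0 < N.+1%:R :> R by rewrite ltr0n.
have scS z : (\sum_i z i)%N = N.+1 -> simplex (sc z).
  move=> zN; split=> [i|]; first by rewrite mxE divr_ge0.
  under eq_bigr do rewrite mxE.
  by rewrite -mulr_suml -natr_sum zN divff // gt_eqF.
have [q qN Hq] := grid_sperner N.+1 (fun z => lab (sc z)) n0.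
have [i qi Giq] := Gcov _ (scS _ qN).
have qi0 : q i != 0%N by apply: contraNneq qi => q0; rewrite mxE q0 mul0r.
have [z [zN zi Hz]] := Hq _ qi0.
apply: (Hlab _ (scS _ zN) (sc q)); last by rewrite zi.
split=> // k j; rewrite !mxE /ball /= -mulrBl normrM [X in _ * X]gtr0_norm ?invr_gt0 //.
rewrite ltr_pdivrMr // mulrC -ltr_pdivrMr //; apply: le_lt_trans N_large.
rewrite ler_pM2r ?invr_gt0 // ler_norml.
have [] := Hz j; rewrite -!(ler_nat R) !natrD -addn1 natrD => h1 h2.
apply/andP; split; lra.
Qed.
End KKM.

(** * Polytopes with vertices in a self segment-dense set *)

Section Density.
Variables (R : realType) (X : tvsType R).

Lemma tvs_continuousD (T : topologicalType) (g h : T -> X) :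
  continuous g -> continuous h -> continuous (fun x => g x + h x).
Proof.
move=> cg ch x.
apply: (@continuous2_cvg _ _ _ _ _ _ _ _ (fun u v : X => u + v) _ _ _ (cg x) (ch x)).
exact: (@add_continuous X (g x, h x)).
Qed.

Lemma tvs_continuousZ (T : topologicalType) (g : T -> R) (h : T -> X) :
  continuous g -> continuous h -> continuous (fun x => g x *: h x).
Proof.
move=> cg ch x.
apply: (@continuous2_cvg _ R^o _ _ _ _ _ _ (fun u (v : X) => u *: v) _ _ _ (cg x) (ch x)).
exact: (@scale_continuous R X (g x, h x)).
Qed.

Lemma segment_continuous (x : X) (t : R) : continuous (fun z : X => x + t *: (z - x)).
Proof.
apply: tvs_continuousD; first exact: cst_continuous.
apply: tvs_continuousZ; first exact: cst_continuous.
by apply: tvs_continuousD => z; [exact: cvg_id|exact: cvg_cst].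
Qed.

Lemma lincomb_continuous n (y : 'I_n -> X) :
  continuous (fun p : 'rV[R]_n => \sum_i p ord0 i *: y i).
Proof.
apply: (continuous_big (op := +%R)); first exact: add_continuous.
move=> i _; apply: tvs_continuousZ; first exact: coord_continuous.
exact: cst_continuous.
Qed.

Variables (D S : set X).
Hypothesis segment_dense : forall x y, D x -> D y -> dense_in (segment x y `&` D) (segment x y).
Hypothesis S_segment : forall x y, S x -> S y -> segment x y `<=` S.

(** The point [z] need not be in [D], so it is first replaced by a nearby [z'] in [D] and [S];
    density on the segment from [x] to [z'] then applies, and that segment stays in [S]. *)
Lemma closure_star (x z : X) (t : R) : D x -> S x -> 0 <= t <= 1 ->
  closure (D `&` S) z -> closure (D `&` S) (x + t *: (z - x)).
Proof.
move=> Dx Sx t01 Ez; apply: closed_closure.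
move=> W Wz.
have [z' [[Dz' Sz'] Wz']] := Ez _ (segment_continuous Wz).
exists (x + t *: (z' - x)); split => //.
have sz' : segment x z' (x + t *: (z' - x)) by exists t.
move=> U Uz; have [u [[su Du] Uu]] := segment_dense Dx Dz' sz' Uz.
by exists u; split => //; split => //; apply: S_segment su.
Qed.

(** By induction, the first point is joined to the renormalised combination of the others, known
    only to be in the closure. Zero weights are exempted because [S] will be a face. *)
Lemma convex_comb_closure n (y : 'I_n -> X) (l : 'I_n -> R) :
  (forall i, l i != 0 -> (D `&` S) (y i)) -> (forall i, 0 <= l i) -> \sum_i l i = 1 ->
  closure (D `&` S) (\sum_i l i *: y i).
Proof.
elim: n => [|n IHn] in y l *.
  by move=> _ _ /eqP; rewrite big_ord0 eq_sym oner_eq0.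
move=> DSy l0; rewrite !big_ord_recl; set T := \sum_(i < n) _ => lT.
have T0 : 0 <= T by apply: sumr_ge0.
have [T_0|T_n0] := eqVneq T 0.
  rewrite big1 => [|i _]; last first.
    suff -> : l (lift ord0 i) = 0 by rewrite scale0r.
    have /eqP := T_0; rewrite psumr_eq0 => [/allP /(_ i)|j _ //].
    by rewrite mem_index_enum => /(_ isT) /eqP.
  move: lT; rewrite T_0 !addr0 => l1; rewrite l1 scale1r.
  by apply: subset_closure; apply: DSy; rewrite l1 oner_eq0.
have -> : \sum_(i < n) l (lift ord0 i) *: y (lift ord0 i) =
    T *: \sum_(i < n) (l (lift ord0 i) / T) *: y (lift ord0 i).
  rewrite scaler_sumr; apply: eq_bigr => i _.
  by rewrite scalerA mulrC divfK.
set z := \sum_(i < n) (_ / _) *: _.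
have Ez : closure (D `&` S) z.
  apply: IHn => [i|i|].
  - by rewrite mulf_eq0 negb_or => /andP [/DSy].
  - by rewrite divr_ge0.
  - by rewrite -mulr_suml divff.
have [ly0|ly0] := eqVneq (l ord0) 0.
  by move: lT; rewrite ly0 add0r scale0r add0r => ->; rewrite scale1r.
have -> : l ord0 *: y ord0 + T *: z = y ord0 + T *: (z - y ord0).
  have -> : l ord0 = 1 - T by rewrite -lT addrK.
  by rewrite scalerBl scale1r scalerBr addrA addrAC.
have [Dy Sy] := DSy _ ly0.
by apply: closure_star => //; rewrite T0 -lT lerDr l0.
Qed.
End Density.

(** * Pointed convex cones *)

Section Cone.
Variables (R : realType) (Z : lmodType R) (C : set Z).
Hypothesis C_convex : is_convex_cone C.
Hypothesis C_pointed : is_pointed C.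

Lemma neg_cone0P z : neg_cone0 C z <-> C (- z) /\ z <> 0.
Proof.
split=> [[[c Cc <-] z0]|[Cz z0]]; first by rewrite opprK.
by split => //; exists (- z); rewrite ?opprK.
Qed.

Lemma cone0 : C 0.
Proof.
have : [set (0 : Z)] 0 by [].
by rewrite -C_pointed => -[].
Qed.

Lemma coneD a b : C a -> C b -> C (a + b).
Proof. by move=> Ca Cb; rewrite -C_convex.2; exists a => //; exists b. Qed.

Lemma coneN_eq0 a : C a -> C (- a) -> a = 0.
Proof.
move=> Ca CNa; have : (C `&` [set - c | c in C]) a.
  by split=> //; exists (- a) => //; rewrite opprK.
by rewrite C_pointed.
Qed.

Lemma cone_le_neg z w : cone_le C z w -> neg_cone0 C w -> neg_cone0 C z.
Proof.
move=> zw /neg_cone0P [Cw w0]; apply/neg_cone0P; split.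
  by have -> : - z = (w - z) - w; [rewrite addrAC subrr add0r|apply: coneD].
by move=> z0; apply: w0; apply: coneN_eq0 => //; move: zw; rewrite /cone_le z0 subr0.
Qed.

(** If the sum vanished, a term of nonzero weight would be the opposite of the sum of the others,
    hence in both [C] and its opposite, and pointedness would make it zero. *)
Lemma neg_cone0_comb n (l : 'I_n -> R) (z : 'I_n -> Z) :
  (forall i, 0 <= l i) -> \sum_i l i = 1 -> (forall i, l i != 0 -> neg_cone0 C (z i)) ->
  neg_cone0 C (\sum_i l i *: z i).
Proof.
move=> l0 l1 Hz.
have Cl i : C (- (l i *: z i)).
  have [->|li] := eqVneq (l i) 0; first by rewrite scale0r oppr0; exact: cone0.
  by rewrite -scalerN; apply: C_convex.1 => //; have /neg_cone0P [] := Hz i li.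
have Csum (P : pred 'I_n) : C (- \sum_(i | P i) l i *: z i).
  rewrite -sumrN; elim/big_ind: _ => //; first exact: cone0.
  exact: coneD.
have [i li] : exists i, l i != 0.
  apply/existsP; apply: contraPT l1 => /existsPn H; rewrite big1 => [/esym/eqP|i _].
    by rewrite oner_eq0.
  by apply/eqP; have := H i; rewrite negbK.
apply/neg_cone0P; split=> // /eqP; rewrite (bigD1 i) //= addr_eq0 => /eqP E.
have /eqP : l i *: z i = 0 by apply: coneN_eq0 => //; rewrite E.
rewrite scaler_eq0 (negbTE li) /= => /eqP zi0.
by have /neg_cone0P [_] := Hz i li.
Qed.
End Cone.

(** * Closed sets from semicontinuity, and their intersections *)

Lemma strongly_usc_closed (R : realType) (X : topologicalType) (Z : lmodType R) (C : set Z)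
    (K : set X) (g : X -> Z) : closed K -> strongly_usc_on C K K g ->
  closed (K `&` [set x | ~ neg_cone0 C (g x)]).
Proof.
move=> Kcl usc x clx.
have Kx : K x by apply: Kcl; apply: closureS clx => u [].
split => //= nx; have [Cgx gx0] := (neg_cone0P C (g x)).1 nx.
(* With [k = - g x] the upper bound [g x + k] is 0, so [g] takes values in [neg_cone0 C] near
   [x]. *)
have [|U Ux HU] := usc _ Kx (- g x).
  by split => // /eqP; rewrite oppr_eq0 => /eqP.
have [u [[Ku nu] Uu]] := clx _ Ux.
have [c [Cc c0] gu] := HU u (conj Uu Ku).
apply: nu; rewrite -gu subrr sub0r; split; first by exists c.
by move=> /eqP; rewrite oppr_eq0 => /eqP.
Qed.

(** The filter generated by the finite intersections contains the compact [F i0], so it has a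
    cluster point, which every closed [F i] contains. *)
Lemma compact_finI_bigcap (T : topologicalType) (I : choiceType) (D : set I)
    (F : I -> set T) (i0 : I) : D i0 -> compact (F i0) ->
  (forall i, D i -> closed (F i)) -> finI D F -> \bigcap_(i in D) F i !=set0.
Proof.
move=> Di0 Fco Fcl FI.
have inF i : D i -> filter_from (finI_from D F) id (F i).
  by move=> Di; exists (F i) => //; apply: finI_from1.
have [p [_ clp]] := Fco _ (finI_filter FI) (inF _ Di0).
by exists p => i Di; apply: (Fcl _ Di) => B; apply: clp; apply: inF.
Qed.

(** * Existence of the equilibrium point *)

Theorem theorem4p3 (R : realType) (X Z : tvsType R)
    (hausX : hausdorff_space X) (hausZ : hausdorff_space Z)
    (C : set Z) (C_convex : is_convex_cone C) (C_pointed : is_pointed C)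
    (K : set X) (K_nonempty : K !=set0) (K_convex : convex_set K)
    (K_closed : closed K)
    (D : set X) (D_sub_K : D `<=` K) (D_dense : self_segment_dense D K)
    (f : X -> X -> Z)
    (usc1 : forall y, D y -> strongly_usc_on C K K (fun x => f x y))
    (usc2 : forall x, K x -> strongly_usc_on C K (K `\` D) (fun y => f x y))
    (convex2 : forall x, D x -> C_convex_on C D (fun y => f x y))
    (diag : forall x, D x -> ~ neg_cone0 C (f x x))
    (coercive : exists K0 : set X, compact K0 /\
      exists y0, D y0 /\ forall x, (K `\` K0) x -> neg_cone0 C (f x y0)) :
  exists x0, K x0 /\ forall y, K y -> ~ neg_cone0 C (f x0 y).
Proof.
have [K0 [K0_compact [y0 [Dy0 K0_far]]]] := coercive.
have [KD Dseg] := D_dense.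
pose F y := K `&` [set x | ~ neg_cone0 C (f x y)].
have Fcl y : D y -> closed (F y) by move=> /usc1; apply: strongly_usc_closed.
have F_finite n (y : 'I_n.+1 -> X) : (forall i, D (y i)) -> exists x, forall i, F (y i) x.
  (* KKM is applied to preimages under the barycentric map, so the [y i] may coincide or be affinely
     dependent. *)
  move=> Dy; pose comb (p : 'rV[R]_n.+1) := \sum_i p ord0 i *: y i.
  have [i|p [p0 p1]|p _ Fp] := @KKM_simplex R n.+1 (fun i => comb @^-1` F (y i)) isT.
  - apply: preimage_closed; last exact: Fcl.
    by move=> p _; apply: lincomb_continuous.
  - apply: contrapT => /forall2NP nF.
    have nFp i : p ord0 i != 0 -> ~ F (y i) (comb p) by case: (nF i).
    (* The face spanned by the [y i] of nonzero weight in [p]. Approximating [comb p] inside it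
       keeps the weights on indices where [nFp] applies. *)
    pose S := [set u | exists m : 'I_n.+1 -> R, [/\ forall i, 0 <= m i, \sum_i m i = 1,
      forall i, p ord0 i = 0 -> m i = 0 & u = \sum_i m i *: y i]].
    have S_segment u v : S u -> S v -> segment u v `<=` S.
      move=> [m [m0 m1 mp ->]] [k [k0 k1 kp ->]] _ [t /andP [t0 t1] <-].
      exists (fun i => m i + t * (k i - m i)); split => [i||i pi|].
      + have -> : m i + t * (k i - m i) = (1 - t) * m i + t * k i.
          by rewrite mulrBr mulrBl mul1r addrA addrAC.
        by rewrite addr_ge0 // mulr_ge0 // subr_ge0.
      + by rewrite big_split /= -mulr_sumr sumrB m1 k1 subrr mulr0 addr0.
      + by rewrite mp // kp // subrr mulr0 addr0.
      + rewrite -sumrB scaler_sumr -big_split; apply: eq_bigr => i _ /=.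
        by rewrite scalerDl -scalerA scalerBl.
    have near_comb : nbhs (comb p) [set u | forall i, p ord0 i != 0 -> ~ F (y i) u].
      suff : forall i, nbhs (comb p) [set u | p ord0 i != 0 -> ~ F (y i) u].
        exact: filter_forall.
      move=> i; have [pi|pi] := eqVneq (p ord0 i) 0; first exact: filterE.
      apply: filterS (_ : nbhs (comb p) (~` F (y i))) => [u nu _ //|].
      apply: open_nbhs_nbhs; split; last exact: nFp.
      by apply: closed_openC; apply: Fcl.
    have Scomb : closure (D `&` S) (comb p).
      apply: convex_comb_closure => // i pi; split => //.
      exists (fun j => (j == i)%:R); split => [j||j pj|].
      + by [].
      + by rewrite (bigD1 i) //= eqxx big1 ?addr0 // => j /negbTE ->.
      + by case: eqVneq => // ji; rewrite -ji pj eqxx in pi.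
      + rewrite (bigD1 i) //= eqxx scale1r big1 ?addr0 // => j /negbTE ->.
        by rewrite scale0r.
    (* All [f u (y i)] of nonzero weight are in [neg_cone0 C]; convexity carries this over to
       [f u u], against [diag]. *)
    have [u [[Du [m [m0 m1 mp uE]]] nFu]] := Scomb _ near_comb.
    apply: (diag u Du).
    apply: (cone_le_neg C_convex C_pointed (w := \sum_i m i *: f u (y i))).
      have Dcomb : D (\sum_i m i *: y i) by rewrite -uE.
      by have := convex2 u Du _ y m Dy m0 m1 Dcomb; rewrite -uE.
    apply: neg_cone0_comb => // i mi; apply: contrapT => nfi.
    apply: (nFu i); first by apply: contraNneq mi => /mp ->.
    by split => //; apply: D_sub_K.
  - by exists (comb p).
have Fy0_compact : compact (F y0).
  apply: subclosed_compact (Fcl _ Dy0) K0_compact _ => x [Kx nx].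
  by apply: contrapT => nK0; apply: nx; apply: K0_far.
have [|x0 Fx0] := @compact_finI_bigcap X X D F y0 Dy0 Fy0_compact Fcl.
  (* Putting [y0] in front makes the family nonempty, as the simplex requires. *)
  move=> D' D'D; pose y (i : 'I_(size D').+1) := nth y0 (y0 :: D') i.
  have [i|x Fx] := F_finite _ y.
    have : y i \in y0 :: D' by apply: mem_nth.
    by rewrite inE => /orP [/eqP ->|/D'D /set_mem].
  exists x => z /= zD'.
  have zs : (index z (y0 :: D') < (size D').+1)%N by rewrite index_mem inE zD' orbT.
  by have := Fx (Ordinal zs); rewrite /y /= nth_index // inE zD' orbT.
have [Kx0 _] := Fx0 _ Dy0.
have nD y : D y -> ~ neg_cone0 C (f x0 y) by move=> /Fx0 [].
exists x0; split => // y Ky; have [/nD //|nDy] := pselect (D y).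
move=> ny; have [Cy y_0] := (neg_cone0P C _).1 ny.
(* The choice [k = - f x0 y] puts [f x0 u] in [neg_cone0 C] for all [u] in [K] near [y], in
   particular for some [u] in [D] by density. *)
have [|U Uy HU] := usc2 _ Kx0 y (conj Ky nDy) (- f x0 y).
  by split => // /eqP; rewrite oppr_eq0 => /eqP.
have [u [Du Uu]] := KD _ Ky _ Uy.
have [c [Cc c0] fu] := HU u (conj Uu (D_sub_K _ Du)).
apply: (nD _ Du); rewrite -fu subrr sub0r; split; first by exists c.
by move=> /eqP; rewrite oppr_eq0 => /eqP.
Qed.
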